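(* Let $p\in[1,\infty]$ and let $(X,d,A)$ be a metric pair where $d$ is non-extended and separated. Assume there exist $x\in X$ and $\varepsilon>0$ such that the closed ball $\overline{B}_\varepsilon(x)$ is compact, $\dim\overline{B}_\varepsilon(x)\ge2$, and $\overline{B}_\varepsilon(x)\cap A^{3\varepsilon}=\emptyset$. Then $\dim(D^n(X,A),W_p)\ge n$ for all $n\in\mathbb{N}$, and hence $\dim(D(X,A),W_p)=\infty$.
   Context: A metric on $X$ is a map $d:X\times X\to[0,\infty]$ with $d(x,x)=0$, symmetry and the triangle inequality; non-extended means all distances are finite, separated means $d(x,y)=0$ implies $x=y$. A metric pair $(X,d,A)$ is such a space with a closed subset $A$. Write $d(x,A)=\inf_{a\in A}d(x,a)$ and $A^\delta=\{y:d(y,A)<\delta\}$. $D(X,A)$ is the set of finite formal sums $\sum_{i=1}^m x_i$ of points of $X\setminus A$ (repetitions allowed), $D^n(X,A)$ those with $m\le n$. A matching of $\hat\alpha=\sum_{i\in I}x_i$, $\hat\beta=\sum_{j\in J}y_j$ is a formal sum $\sum_{k\in K}(x_k,y_{\varphi(k)})+\sum_{i\in I\setminus K}(x_i,z_i)+\sum_{j\in J\setminus\varphi(K)}(w_j,y_j)$ with $K\subset I$, $\varphi$ injective, $z_i,w_j\in A$; its $p$-cost is the $\ell^p$ norm (sup norm if $p=\infty$) of the distances of paired points; $W_p$ is the infimum of $p$-costs. $\dim$ denotes Lebesgue covering dimension: the smallest $n$ such that every open cover has an open refinement of order $n+1$ (a family has order $n$ if some point lies in $n$ of its members but no point lies in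 $n+1$). *)

(* Defs.v *)
From HB Require Import structures.
From mathcomp Require Import all_boot all_order all_algebra.
From mathcomp Require Import all_classical all_reals all_analysis.
Set Implicit Arguments. Unset Strict Implicit. Unset Printing Implicit Defensive.
Import Order.TTheory GRing.Theory Num.Theory.
Local Open Scope classical_set_scope.
Local Open Scope ring_scope.

Definition pd_relopen {T : Type} (op : set T -> Prop) (S v : set T) : Prop :=
  exists w, op w /\ v = w `&` S.

Definition pd_order_le {T : Type} (V : set (set T)) (k : nat) : Prop :=
  forall f : 'I_k.+1 -> set T, injective f -> (forall i, V (f i)) ->
  forall t, ~ (forall i, f i t).

Definition pd_covdim_le {T : Type} (op : set T -> Prop) (S : set T) (n : nat) : Prop :=
  forall U : set (set T),
    (forall u, U u -> pd_relopen op S u) -> S `<=` \bigcup_(u in U) u ->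
    exists V : set (set T),
      [/\ (forall v, V v -> pd_relopen op S v),
          S `<=` \bigcup_(v in V) v,
          (forall v, V v -> exists2 u, U u & v `<=` u)
        & pd_order_le V n.+1].

Definition pd_covdim_ge {T : Type} (op : set T -> Prop) (S : set T) (n : nat) : Prop :=
  forall m, (m < n)%N -> ~ pd_covdim_le op S m.

Definition pd_covdim_infinite {T : Type} (op : set T -> Prop) (S : set T) : Prop :=
  forall m, ~ pd_covdim_le op S m.

Definition pd_mopen {R : realType} {T : Type} (e : T -> T -> \bar R) (U : set T) : Prop :=
  forall t, U t -> exists2 r : R, 0 < r & forall t', (e t t' < r%:E)%E -> U t'.

Definition pd_mclosed {R : realType} {T : Type} (e : T -> T -> \bar R) (F : set T) : Prop :=
  pd_mopen e (~` F).

Definition pd_mcompact {R : realType} {T : Type} (e : T -> T -> \bar R) (K : set T) : Prop :=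
  forall U : set (set T), (forall u, U u -> pd_mopen e u) -> K `<=` \bigcup_(u in U) u ->
  exists2 F : set (set T), F `<=` U /\ finite_set F & K `<=` \bigcup_(u in F) u.

Definition pd_edist {R : realType} {X : Type} (d : X -> X -> R) : X -> X -> \bar R :=
  fun x y => (d x y)%:E.

Definition pd_cball {R : realType} {X : Type} (d : X -> X -> R) (x : X) (r : R) : set X :=
  [set y | d x y <= r].

(* d(y,A) = inf_{a in A} d(y,a)   (= +oo if A is empty) *)
Definition pd_dist_to {R : realType} {X : Type} (d : X -> X -> R) (y : X) (A : set X) : \bar R :=
  ereal_inf [set (d y a)%:E | a in A].

Definition pd_thick {R : realType} {X : Type} (d : X -> X -> R) (A : set X) (delta : R) : set X :=
  [set y | (pd_dist_to d y A < delta%:E)%E].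

(* Persistence diagrams: finite formal sums of points of X \ A,        *)
(* represented by their multiplicity functions.                        *)
Definition pd_mult {X : Type} (m : nat) (x : 'I_m -> X) : X -> nat :=
  fun y => (\sum_(i < m) nat_of_bool `[< x i = y >])%N.

Record pd_diagram (X : Type) (A : set X) := pd_Diagram {
  pd_dmult : X -> nat;
  pd_dmult_finsum : exists m (x : 'I_m -> X), (forall i, ~ A (x i)) /\ pd_dmult = pd_mult x }.

Definition pd_represents {X : Type} {A : set X} (alpha : pd_diagram A) (m : nat) (x : 'I_m -> X) :=
  (forall i, ~ A (x i)) /\ pd_dmult alpha = pd_mult x.

Definition pd_Dn {X : Type} (A : set X) (n : nat) : set (pd_diagram A) :=
  [set alpha | exists m (x : 'I_m -> X), (m <= n)%N /\ pd_represents alpha x].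

(* A matching of sum_i x_i and sum_j y_j: partial injection phi from indices of x
   (K = {i | phi i <> None}) into indices of y; unmatched x_i are paired with
   z_i in A, unmatched y_j are paired with w_j in A. *)
Definition pd_is_matching {X : Type} (A : set X) (m k : nat)
  (phi : 'I_m -> option 'I_k) (z : 'I_m -> X) (w : 'I_k -> X) : Prop :=
  [/\ (forall i i' j, phi i = Some j -> phi i' = Some j -> i = i'),
      (forall i, phi i = None -> A (z i))
    & (forall j, (forall i, phi i <> Some j) -> A (w j))].

Definition pd_lp_norm {R : realType} (p : \bar R) (m k : nat)
  (a : 'I_m -> R) (P : pred 'I_k) (b : 'I_k -> R) : \bar R :=
  match p with
  | +oo%E => (Num.max (\big[Num.max/0]_(i < m) a i)
                      (\big[Num.max/0]_(j < k | P j) b j))%:E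
  | (r%:E)%E => (powR (\sum_(i < m) powR (a i) r + \sum_(j < k | P j) powR (b j) r) r^-1)%:E
  | -oo%E => +oo%E
  end.

Definition pd_matching_cost {R : realType} {X : Type} (d : X -> X -> R) (p : \bar R)
  (m k : nat) (x : 'I_m -> X) (y : 'I_k -> X)
  (phi : 'I_m -> option 'I_k) (z : 'I_m -> X) (w : 'I_k -> X) : \bar R :=
  pd_lp_norm p
    (fun i => match phi i with Some j => d (x i) (y j) | None => d (x i) (z i) end)
    (fun j => ~~ `[< exists i, phi i = Some j >])
    (fun j => d (w j) (y j)).

Definition pd_Wp {R : realType} {X : Type} (d : X -> X -> R) (A : set X) (p : \bar R)
  (alpha beta : pd_diagram A) : \bar R :=
  ereal_inf [set c | exists m (x : 'I_m -> X) k (y : 'I_k -> X)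
                        (phi : 'I_m -> option 'I_k) (z : 'I_m -> X) (w : 'I_k -> X),
                 [/\ pd_represents alpha x, pd_represents beta y, pd_is_matching A phi z w
                   & c = pd_matching_cost d p x y phi z w]].

Arguments pd_Wp {R X} d A p alpha beta.
Arguments pd_Dn {X} A n.
Arguments pd_is_matching {X} A {m k} phi z w.

(* Main.v *)
Require Import Defs.
From HB Require Import structures.
From mathcomp Require Import all_boot all_order all_algebra.
From mathcomp Require Import all_classical all_reals all_analysis.
From mathcomp Require Import zify ring lra.
Set Implicit Arguments. Unset Strict Implicit. Unset Printing Implicit Defensive.
Import Order.TTheory GRing.Theory Num.Theory.
Local Open Scope classical_set_scope.
Local Open Scope ring_scope.

(** Since the ball K has positive dimension and is compact, it contains, from some
    fixed point a, arbitrarily fine chains reaching a fixed distance H from a.  Cut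
    [0, H] into n bands, and let G_i be the maximum over the points x of a diagram of
    a tent function of d(a, x) supported in the i-th band; since K is far from A, the
    G_i are continuous on diagrams.  Diagrams made of one chain point per band form a
    fine grid on which (G_1, ..., G_n) behaves like the coordinates of a cube.  An open
    refinement of low order of the cover by the sets "G_i is large for i in T, not large
    for i not in T" would label the grid vertices so as to contradict the cubical
    Sperner (Kuhn) lemma; the latter is proved by integrating mod 2 cochains over
    the cube, one coordinate at a time. *)

(** * Mod 2 cochains and Kuhn's lemma *)

(** Cochains are boolean functions of vertex sequences and [(+)] is addition mod 2, so faces carry
    no signs. *)
Fixpoint coboundary (V : Type) (f : seq V -> bool) (v : seq V) : bool :=
  if v is x :: v' then f v' (+) coboundary (fun w => f (x :: w)) v' else false.

Lemma coboundary_map (V W : Type) (e : V -> W) (f : seq W -> bool) (v : seq V) :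
  coboundary (fun w => f (map e w)) v = coboundary f (map e v).
Proof. by elim: v f => //= x v IH f; rewrite (IH (fun w => f (e x :: w))). Qed.

Section MixedCochains.
Variable V : eqType.
Implicit Types (f g : seq V -> bool) (v w : seq V) (e : V -> V).

(* Value of the cochain f on the triangulated prism with lower face v and upper face [map e v]. *)
Fixpoint prism e f v : bool :=
  if v is x :: v' then
    f (x :: map e v) (+) prism e (fun w => f (x :: w)) v'
  else false.

Fixpoint sweep e N f v : bool :=
  if N is M.+1 then sweep e M f v (+) prism e f (map (iter M e) v) else false.

Lemma eq_coboundary f g v : f =1 g -> coboundary f v = coboundary g v.
Proof.
elim: v f g => //= x v IH f g fg; rewrite fg; congr (_ (+) _).
by apply: IH => w; rewrite fg.
Qed.

Lemma coboundary0 v : coboundary (fun=> false) v = false.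
Proof. by elim: v. Qed.

Lemma coboundaryD f g v :
  coboundary (fun w => f w (+) g w) v = coboundary f v (+) coboundary g v.
Proof.
elim: v f g => //= x v IH f g.
by rewrite IH; rewrite !addbA; congr (_ (+) _); rewrite -!addbA; congr (_ (+) _); rewrite addbC.
Qed.

Lemma prismD e f g v :
  prism e (fun w => f w (+) g w) v = prism e f v (+) prism e g v.
Proof.
elim: v f g => //= x v IH f g.
by rewrite IH; rewrite !addbA; congr (_ (+) _); rewrite -!addbA; congr (_ (+) _); rewrite addbC.
Qed.

(** Chain homotopy formula: mod 2, the boundary of a prism consists of its two ends and of the prism
    over the boundary of its base. *)
Lemma prism_homotopy e f v :
  prism e (coboundary f) v (+) coboundary (prism e f) v = f (map e v) (+) f v.
Proof.
elim: v f => [|x v IH] f /=; first by rewrite addbb.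
rewrite prismD coboundaryD (coboundary_map e (fun w => f (x :: e x :: w))).
have := IH (fun w => f (x :: w)) => /=.
move: (prism _ _ _) (prism _ _ _) (coboundary _ _) (coboundary _ _) (f _) (f _) (f _).
by do 7![case] => //.
Qed.

Lemma sweep_homotopy e N f v :
  sweep e N (coboundary f) v (+) coboundary (sweep e N f) v
  = f (map (iter N e) v) (+) f v.
Proof.
elim: N => [|N IH] /=.
  by rewrite map_id addbb coboundary0.
rewrite coboundaryD (coboundary_map (iter N e)).
have := prism_homotopy e f (map (iter N e) v).
rewrite -map_comp (_ : map (e \o iter N e) v = map (iter N.+1 e) v) //=.
move: IH; move: (sweep _ _ _ _) (prism _ _ _) (coboundary _ _) (coboundary _ _) (f _) (f _) (f _).
by do 7![case] => //.
Qed.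

Lemma prism_eq0 e f v :
  (forall w, {in w, forall u, exists2 x, x \in v & u = x \/ u = e x} -> f w = false) ->
  prism e f v = false.
Proof.
elim: v f => //= x v IH f f0; rewrite f0 ?IH //.
- move=> w wv; apply: f0 => u; rewrite inE => /predU1P[->|/wv[y yv uE]].
    by exists x; rewrite ?mem_head //; left.
  by exists y => //; rewrite inE yv orbT.
- move=> u; rewrite inE => /predU1P[->|].
    by exists x; rewrite ?mem_head //; left.
  by move=> /(mapP (s := x :: v))[y yv ->]; exists y => //; right.
Qed.

Lemma sweep_eq0 e N f v :
  (forall t w, (t < N)%N ->
    {in w, forall u, exists2 x, x \in v & u = iter t e x \/ u = iter t.+1 e x} ->
    f w = false) ->
  sweep e N f v = false.
Proof.
elim: N => //= N IH f0; rewrite IH => [|t w tN]; last by apply: f0; lia.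
apply: prism_eq0 => w wv; apply: (f0 N) => // u /wv[_ /mapP[x xv ->] uE].
by exists x.
Qed.

Lemma sweepD e N f g v :
  sweep e N (fun w => f w (+) g w) v = sweep e N f v (+) sweep e N g v.
Proof. by elim: N => //= N ->; rewrite prismD -!addbA; congr (_ (+) _); rewrite addbCA. Qed.

Lemma sweep_nil e N f : sweep e N f [::] = false.
Proof. by elim: N => //= N ->. Qed.

Lemma coboundary_perm_eq (t v w : seq V) :
  coboundary (fun u => perm_eq (w ++ u) t) v
  = odd (count (fun x => perm_eq (w ++ v) (x :: t)) v).
Proof.
elim: v w => //= x v IH w.
have -> : perm_eq (w ++ v) t = perm_eq (w ++ x :: v) (x :: t).
  by rewrite -(perm_cons x) -[x :: v]cat1s [RHS]perm_catCA.
rewrite oddD oddb -cat_rcons -IH; congr (_ (+) _).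
by apply: eq_coboundary => u; rewrite cat_rcons.
Qed.
End MixedCochains.

(** * Integration over the cube and Kuhn's lemma *)

Section KuhnLemma.
Local Open Scope nat_scope.
Implicit Types (u b : nat -> nat) (v w : seq (nat -> nat)) (f : seq (nat -> nat) -> bool).

Definition shift (k : nat) u : nat -> nat := fun i => u i + (i == k).

Lemma iter_shift t k u i : iter t (shift k) u i = u i + t * (i == k).
Proof. by elim: t => [|t IH] /=; rewrite /shift ?IH; lia. Qed.

(* Evaluation of a k-cochain on the triangulated cube [0, N]^k x 0. *)
Fixpoint cube_eval (N k : nat) f : bool :=
  if k is k'.+1 then cube_eval N k' (sweep (shift k') N f) else f [:: fun=> 0].

(** The vertices share one unit cell of the grid [[0, N]^k], with lower corner [b]; their order and
    number are left free. *)
Definition small (N k : nat) v :=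
  exists b, forall u, u \in v -> forall i,
    if i < k then [/\ b i <= u i, u i <= (b i).+1 & u i <= N] else u i = 0.

Lemma smallW N k k' v : k <= k' -> small N k v -> small N k' v.
Proof.
move=> kk' [b vb]; exists (fun i => if i < k then b i else 0) => u /vb ub i.
by have := ub i; case: ifPn => ik; [rewrite (leq_trans ik kk')|case: ifP => // _ ->].
Qed.

Lemma small_sweep N k t v w : t < N -> small N k v ->
  {in w, forall u, exists2 x, x \in v & u = iter t (shift k) x \/ u = iter t.+1 (shift k) x} ->
  small N k.+1 w.
Proof.
move=> tN [b vb] wv; exists (fun i => if i == k then t else b i) => u /wv[x /vb xb] uE i.
have {uE} : u i = x i + t * (i == k) \/ u i = x i + t.+1 * (i == k).
  by case: uE => ->; rewrite iter_shift; [left|right].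
have := xb i; rewrite ltnS; case: (ltngtP i k) => //= ik.
- by case=> ? ? ?; split; lia.
- lia.
- by move=> ?; split; lia.
Qed.

Lemma eval0 N k f : (forall v, small N k v -> f v = false) -> cube_eval N k f = false.
Proof.
elim: k f => [|k IH] f f0 /=.
  by apply: f0; exists (fun=> 0) => u; rewrite inE => /eqP-> i.
apply: IH => v vk; apply: sweep_eq0 => t w tN /(small_sweep tN vk); exact: f0.
Qed.

Lemma evalD N k f g :
  cube_eval N k (fun v => f v (+) g v) = cube_eval N k f (+) cube_eval N k g.
Proof.
elim: k f g => //= k IH f g; rewrite -IH; congr cube_eval.
by apply/funext => v; rewrite sweepD.
Qed.

Lemma eq_eval N k f g : (forall v, small N k v -> f v = g v) ->
  cube_eval N k f = cube_eval N k g.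
Proof.
move=> fg; have : cube_eval N k (fun v => f v (+) g v) = false.
  by apply: eval0 => v /fg ->; rewrite addbb.
by rewrite evalD; case: cube_eval; case: cube_eval.
Qed.

(** The homotopy formula in direction [k] splits off the upper and lower faces of the cube; the last
    term carries the faces in the other directions. *)
Lemma eval_sweep_coboundary N k f :
  cube_eval N k.+1 (coboundary f) =
  cube_eval N k (fun v => f (map (iter N (shift k)) v)) (+) cube_eval N k f
  (+) cube_eval N k (coboundary (sweep (shift k) N f)).
Proof.
rewrite -!evalD /=; congr cube_eval; apply/funext => v.
by rewrite -sweep_homotopy -addbA addbb addbF.
Qed.

Lemma small_lower_face N k v : small N k v -> {in v, forall u, u k = 0}.
Proof. by move=> [b vb] u /vb /(_ k); rewrite ltnn. Qed.

Lemma small_upper_face N k v : small N k v ->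
  small N k.+1 (map (iter N (shift k)) v) /\
  {in map (iter N (shift k)) v, forall u, u k = N}.
Proof.
move=> vk; split; last first.
  by move=> _ /mapP[u uv ->]; rewrite iter_shift (small_lower_face vk uv) eqxx muln1.
case: vk => b vb; exists (fun i => if i == k then N else b i) => _ /mapP[u /vb ub ->] i.
rewrite iter_shift; have := ub i; rewrite ltnS; case: (ltngtP i k) => //= ik.
- by rewrite muln0 addn0.
- by rewrite muln0 addn0.
- by move=> ->; rewrite muln1 add0n.
Qed.

(** Stokes: only boundary faces contribute. The condition on [[::]] settles dimension 0, where the
    single vertex has the empty face. *)
Lemma eval_coboundary N k f : f [::] = false ->
  (forall v i, i < k -> small N k v ->
     {in v, forall u, u i = 0} \/ {in v, forall u, u i = N} -> f v = false) ->
  cube_eval N k (coboundary f) = false.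
Proof.
elim: k f => [|k IH] f fnil f0; first by rewrite /= fnil.
rewrite eval_sweep_coboundary IH; last first.
- move=> v i ik vk vi; apply: sweep_eq0 => t w tN wv.
  apply: (f0 w i); [lia|exact: small_sweep tN vk wv|].
  have iE u x : u = iter t (shift k) x \/ u = iter t.+1 (shift k) x -> u i = x i.
    by move=> [] ->; rewrite iter_shift; lia.
  by case: vi => vi; [left|right] => u /wv[x xv /iE ->]; exact: vi.
- exact: sweep_nil.
rewrite addbF.
have -> : cube_eval N k f = false.
  apply: eval0 => v vk; apply: (f0 _ k) => //; first exact: smallW vk.
  by left; exact: small_lower_face vk.
rewrite addbF; apply: eval0 => v /small_upper_face[vk vN].
by apply: (f0 _ k) => //; right.
Qed.

(** Sperner's parity count: labels exactly [0..k+1] give one face labelled [0..k], labels [0..k]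
    with one repeated give two, and anything else gives none. *)
Lemma coboundary_perm_iota k (s : seq nat) : {in s, forall l, l <= k.+1} ->
  coboundary (fun r => perm_eq r (iota 0 k.+1)) s = perm_eq s (iota 0 k.+2).
Proof.
move=> sk; set t := iota 0 k.+1.
rewrite (coboundary_perm_eq t s [::]) -[odd _]/(odd (count (fun x => perm_eq s (x :: t)) s)).
have -> : iota 0 k.+2 = rcons t k.+1 by rewrite -cats1 -(iotaD 0 k.+1 1) addn1.
rewrite perm_sym perm_rcons perm_sym.
have [/hasP[x xs sx]|] := boolP (has (fun x => perm_eq s (x :: t)) s); last first.
  move=> /[dup] ns; rewrite has_count -eqn0Ngt => /eqP ->.
  apply/esym/negbTE; apply: contra ns => sk1; apply/hasP; exists k.+1 => //.
  by rewrite (perm_mem sk1) mem_head.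
have cE y : perm_eq s (y :: t) = (y == x).
  rewrite (permPl sx); apply/idP/eqP => [|->] //.
  move=> /permP/(_ (pred1 y)) /=; rewrite eqxx eq_sym; case: eqP => // _; lia.
rewrite (eq_count cE) cE (permP sx) /= eqxx count_uniq_mem ?iota_uniq //.
have := sk _ xs; rewrite mem_iota /= add0n ltnS.
by rewrite leq_eqVlt ltnS eq_sym => /predU1P[<-|xk]; [rewrite eqxx ltnn|rewrite xk; case: eqP => // xE; lia].
Qed.

(** By induction on [k], the simplices of [[0, N]^k] labelled exactly by [0..k] are odd in number:
    the homotopy formula moves the count to the boundary, where only the newest lower face
    contributes. *)
Lemma kuhn (N n : nat) (label : (nat -> nat) -> nat) :
  let grid u := forall i, if i < n then (u i <= N : Prop) else u i = 0 in
  (forall u, grid u -> label u <= n) ->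
  (forall u i, grid u -> i < n -> u i = 0 -> label u <= i) ->
  (forall u i, grid u -> i < n -> u i = N -> label u <> i) ->
  exists2 v, small N n v & perm_eq (map label v) (iota 0 n.+1).
Proof.
move=> grid lab_le lab_lower lab_upper.
pose f k v := perm_eq (map label v) (iota 0 k.+1).
have smallg k v u : k <= n -> small N k v -> u \in v -> grid u.
  move=> kn /(smallW kn)[b vb] /vb ub i; have := ub i.
  by case: ifP => // _ [].
have lab_small k v u : k <= n -> small N k v -> u \in v -> label u <= k.
  move=> kn vk uv; have gu := smallg _ _ _ kn vk uv.
  have [->|k_n] := eqVneq k n; first exact: lab_le.
  by apply: lab_lower => //; [lia|exact: small_lower_face vk u uv].
have eval1 k : k <= n -> cube_eval N k (f k).
  elim: k => [|k IH] kn.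
    rewrite /= /f /=; set l := label _; suff -> : l = 0 by [].
    apply/eqP; rewrite -leqn0; apply: (lab_small 0 [:: fun=> 0]); rewrite ?mem_head //.
    by exists (fun=> 0) => u; rewrite inE => /eqP-> i.
  have -> : cube_eval N k.+1 (f k.+1) = cube_eval N k.+1 (coboundary (f k)).
    apply: eq_eval => v vk; rewrite /f -coboundary_perm_iota.
      by rewrite -(coboundary_map label (fun r => perm_eq r (iota 0 k.+1))).
    by move=> _ /mapP[u uv ->]; exact: lab_small vk uv.
  (* On an upper face [u i = N] the label [i] is missing; on a lower face [u i = 0] with [i < k] the
     label [k] is missing. *)
  have label_face v i : i <= k -> (forall u, u \in v -> grid u) ->
      (i < k /\ {in v, forall u, u i = 0}) \/ {in v, forall u, u i = N} ->
      f k v = false.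
    move=> ik vg vi; apply/negP => fv.
    have labP l : l <= k -> exists2 u, u \in v & l = label u.
      by move=> lk; apply/mapP; rewrite (perm_mem fv) mem_iota; lia.
    have ik1 : i < n by apply: leq_ltn_trans kn.
    case: vi => [[ik' vi]|vi].
      have [u uv lE] := labP k (leqnn k).
      by have := lab_lower _ _ (vg _ uv) ik1 (vi _ uv); lia.
    have [u uv lE] := labP i ik.
    exact: lab_upper (vg _ uv) ik1 (vi _ uv) (esym lE).
  rewrite eval_sweep_coboundary IH ?(ltnW kn)// eval_coboundary.
  - rewrite addbF eval0// => v /small_upper_face[vk vN].
    apply: (label_face _ k) => //; last by right.
    by move=> u; exact: smallg vk.
  - exact: sweep_nil.
  - move=> v i ik vk vi; apply: sweep_eq0 => t w tN wv.
    apply: (label_face _ i); first exact: ltnW.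
      by move=> u; apply: smallg kn _; exact: small_sweep tN vk wv.
    have iE u x : u = iter t (shift k) x \/ u = iter t.+1 (shift k) x -> u i = x i.
      by move=> [] ->; rewrite iter_shift; lia.
    by case: vi => vi; [left; split=> //|right] => u /wv[x xv /iE ->]; exact: vi.
apply: contrapT => nex; have := eval1 _ (leqnn n).
rewrite eval0 // => v vn; apply/negP => fv; apply: nex; by exists v.
Qed.
End KuhnLemma.

(** * Chains in compact metric spaces *)
Section CompactMetric.
Variables (R : realType) (X : Type) (d : X -> X -> R).
Hypothesis d_refl : forall x, d x x = 0.
Hypothesis d_sym : forall x y, d x y = d y x.
Hypothesis d_tri : forall x y z, d x z <= d x y + d y z.
Variable K : set X.

Inductive chain_reach (delta : R) (a : X) : X -> Prop :=
| chain_reach0 : chain_reach delta a a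
| chain_reachS x y : chain_reach delta a x -> K y -> d x y < delta -> chain_reach delta a y.

Lemma chain_reach_mem delta a x : K a -> chain_reach delta a x -> K x.
Proof. by move=> Ka; case. Qed.

Lemma chain_reach_trans delta a b x :
  chain_reach delta a b -> chain_reach delta b x -> chain_reach delta a x.
Proof. by move=> ab; elim=> // y z _ ay; exact: chain_reachS. Qed.

Lemma chain_reach_sym delta a x : K a -> chain_reach delta a x -> chain_reach delta x a.
Proof.
move=> Ka; elim=> [|y z ay IH Kz yz]; first exact: chain_reach0.
apply: chain_reach_trans IH; apply: chain_reachS (chain_reach0 _ _) _ _.
  exact: chain_reach_mem Ka ay.
by rewrite d_sym.
Qed.

Lemma chain_reach_le delta delta' a x : delta <= delta' ->
  chain_reach delta a x -> chain_reach delta' a x.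
Proof.
move=> dd; elim=> [|y z _ ay Kz yz]; first exact: chain_reach0.
exact: chain_reachS ay Kz (lt_le_trans yz dd).
Qed.

Lemma chain_reach_seq delta a x : 0 < delta -> K a -> chain_reach delta a x ->
  exists (c : nat -> X) M,
    [/\ c 0%N = a, c M = x, forall t, K (c t) & forall t, d (c t) (c t.+1) < delta].
Proof.
move=> delta0 Ka; elim=> [|y z _ [c [M [c0 cM cK cd]]] Kz yz].
  by exists (fun=> a), 0%N; split => // t; rewrite d_refl.
exists (fun t => if (t <= M)%N then c t else z), M.+1; split => //.
- by rewrite ltnn.
- by move=> t; case: ifP.
- by move=> t; case: (ltngtP t M) => [_|_|->]; rewrite ?d_refl ?cM.
Qed.

Hypothesis K_compact : pd_mcompact (pd_edist d) K.

Lemma ball_open y r : pd_mopen (pd_edist d) [set z | d y z < r].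
Proof.
move=> z /= yz; exists (r - d y z); first by rewrite subr_gt0.
move=> z'; rewrite /pd_edist lte_fin => zz'; have := d_tri y z z'; lra.
Qed.

Lemma finite_uniform_gt0 (T : choiceType) (F : set T) (Q : T -> R -> Prop) :
  finite_set F -> (forall u, F u -> exists2 r, 0 < r & Q u r) ->
  exists2 r0, 0 < r0 & forall u, F u -> exists2 r, r0 <= r & Q u r.
Proof.
move=> /finite_seqP[s ->] {F}; elim: s => [|u s IH] sQ.
  by exists 1 => // u; rewrite /= in_nil.
have [r r0 ur] := sQ u (mem_head _ _).
have [|r' r'0 sr] := IH; first by move=> v /= vs; apply: sQ; rewrite /= inE vs orbT.
exists (Num.min r r'); first by rewrite lt_min r0.
move=> v /=; rewrite inE => /predU1P[->|vs]; first by exists r; rewrite // ge_min lexx.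
by have [r1 rr1 ?] := sr v vs; exists r1 => //; rewrite ge_min rr1 orbT.
Qed.

(** Lebesgue number argument: finitely many balls given by [Q] cover [K], and [r0] bounds their
    radii from below. *)
Lemma compact_uniform_gt0 (Q : X -> R -> Prop) :
  (forall y, K y -> exists2 r, 0 < r & Q y r) ->
  exists2 r0, 0 < r0 & forall x, K x -> exists y r, [/\ Q y r, d y x < r & r0 <= r].
Proof.
move=> KQ.
pose U := [set u : set X | exists y r, [/\ 0 < r, Q y r & u = [set z | d y z < r]]].
have [||F [FU finF] KF] := K_compact (U := U).
- by move=> _ [y [r [_ _ ->]]]; exact: ball_open.
- move=> y Ky; have [r r0 yr] := KQ y Ky.
  by exists [set z | d y z < r] => /=; [exists y, r|rewrite d_refl].
have [|r0 r0_gt0 FQ] := @finite_uniform_gt0 _ F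
    (fun u r => exists y, Q y r /\ u = [set z | d y z < r]) finF.
  by move=> u /FU[y [r [? ? ?]]]; exists r => //; exists y.
exists r0 => // x /KF[u /FQ[r r0r [y [yr ->]]] /= yx].
by exists y, r.
Qed.

(** Otherwise each point has a scale at which its chain component stays in a given neighbourhood.
    Compactness makes the scale uniform, and the components at that scale form a relatively open
    partition refining [U]. *)
Lemma chains_of_covdim_gt0 : ~ pd_covdim_le (pd_mopen (pd_edist d)) K 0 ->
  exists a H, [/\ K a, 0 < H & forall delta, 0 < delta ->
    exists2 x, chain_reach delta a x & H <= d a x].
Proof.
apply: contra_notP => /forallNP nchain U Uopen KU.
have [|r0 r0_gt0 KQ] := @compact_uniform_gt0
    (fun y r => exists2 u, U u & forall x, chain_reach r y x -> u x).
  move=> y Ky; have [u Uu uy] := KU _ Ky.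
  have [w [wopen uE]] := Uopen u Uu.
  have [H H0 yH] : exists2 r : R, 0 < r & forall x, (pd_edist d y x < r%:E)%E -> w x.
    by apply: wopen; move: uy; rewrite uE => -[].
  move: (nchain y) => /forallNP/(_ H)/not_and3P; case => // /existsNP[delta].
  move=> /not_implyP[delta0 /forall2NP nx]; exists delta => //; exists u => // x yx.
  rewrite uE; split; last exact: chain_reach_mem Ky yx.
  by apply: yH; rewrite lte_fin; case: (nx x) => // /negP; rewrite -ltNge.
exists [set v | exists2 y, K y & v = [set x | chain_reach r0 y x]]; split.
- move=> _ [y Ky ->].
  (* The open [r0]-neighbourhood of a chain component meets [K] exactly in that component. *)
  exists [set z | exists2 x, chain_reach r0 y x & d x z < r0]; split.
    move=> z [x yx xz]; exists (r0 - d x z); first by rewrite subr_gt0.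
    move=> z'; rewrite lte_fin => zz'; exists x => //; have := d_tri x z z'; lra.
  apply/seteqP; split => z /=.
    by move=> yz; split; [exists z; rewrite ?d_refl|exact: chain_reach_mem Ky yz].
  by move=> [[x yx xz] Kz]; exact: chain_reachS yx Kz xz.
- move=> y Ky; exists [set x | chain_reach r0 y x]; first by exists y.
  exact: chain_reach0.
- move=> _ [y Ky ->]; have [a [r [[u Uu ru] ay r0r]]] := KQ y Ky.
  exists u => // x /(chain_reach_le r0r) yx; apply: ru.
  by apply: chain_reach_trans yx; exact: chain_reachS (chain_reach0 _ _) Ky ay.
move=> f finj fV t ft.
have [y Ky yE] := fV ord0; have [y' Ky' yE'] := fV ord_max.
have /finj // : f ord0 = f ord_max.
have := ft ord0; have := ft ord_max; rewrite yE yE' /= => y't yt.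
have yy' : chain_reach r0 y y' by apply: chain_reach_trans yt (chain_reach_sym Ky' y't).
apply/seteqP; split => z /=; last exact: chain_reach_trans.
by apply: chain_reach_trans; exact: chain_reach_sym.
Qed.

(** A Lebesgue number on the power [K^n]: the coordinates are released one at a time, each by
    compactness of [K]. *)
Lemma compact_power_uniform (n : nat) (P : (nat -> X) -> R -> Prop) :
  let Kn x := forall i, (i < n)%N -> K (x i) in
  (forall x r r', r' <= r -> P x r -> P x r') ->
  (forall x, Kn x -> exists2 r, 0 < r &
     forall x', Kn x' -> (forall i, (i < n)%N -> d (x i) (x' i) < r) -> P x' r) ->
  forall a, K a -> exists2 r, 0 < r & forall x, Kn x -> P x r.
Proof.
move=> Kn Pmono Ploc a Ka.
(* At stage [k] closeness is required only in the coordinates from [k] on; at [k = n] none is left,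
   and the constant sequence [a] serves as centre. *)
have step k : (k <= n)%N -> forall x, Kn x -> exists2 r, 0 < r &
     forall x', Kn x' -> (forall i, (k <= i < n)%N -> d (x i) (x' i) < r) -> P x' r.
  elim: k => [|k IH] kn x Kx; first exact: Ploc.
  pose upd y i := if i == k then y else x i.
  have [y Ky|r0 r0_gt0 KQ] := @compact_uniform_gt0 (fun y r => forall x', Kn x' ->
      (forall i, (k <= i < n)%N -> d (upd y i) (x' i) < r) -> P x' r).
    by apply: (IH (ltnW kn)) => i ik; rewrite /upd; case: eqP => // _; exact: Kx.
  exists r0 => // x' Kx' xx'.
  have [y [r [yr yx' r0r]]] := KQ _ (Kx' k kn).
  apply: (Pmono _ _ _ r0r); apply: yr => // i /andP[ki ik]; rewrite /upd; case: eqP => [->//|ik'].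
  by apply: lt_le_trans r0r; apply: xx'; lia.
have [//|r r0 Pr] := step n (leqnn n) (fun=> a); exists r => // x Kx.
by apply: Pr => // i; lia.
Qed.

Lemma crossing (f : nat -> R) lo hi M : f 0%N <= lo -> lo < hi -> hi <= f M ->
  exists s e, [/\ (s < e)%N, f s <= lo, hi <= f e &
    forall t, (s < t < e)%N -> lo < f t < hi].
Proof.
move=> f0 lohi fM.
have [e fe emin] := ex_minnP (ex_intro (fun t => hi <= f t) M fM).
have [||s /andP[se fs] smax] := @ex_maxnP (fun t => (t <= e)%N && (f t <= lo)) e.
- by exists 0%N.
- by move=> t /andP[].
exists s, e; split => //.
  rewrite ltn_neqAle se andbT; apply/eqP => seq; move: fs fe; rewrite seq; lra.
move=> t /andP[st te]; apply/andP; split; rewrite ltNge; apply/negP => ft.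
  by have := smax t; rewrite (ltnW te) ft => /(_ isT); lia.
by have := emin t ft; lia.
Qed.

(** All the sequences are pieces of one long chain, the [i]-th crossing the band from [2ih] to
    [(2i+1)h] and overshooting its ends by less than one step. Gaps of width [h] separate the
    bands. *)
Lemma chain_bands a H delta (n : nat) (h := H / (2 * n%:R)) :
  0 < H -> 0 < delta -> K a -> (exists2 x, chain_reach delta a x & H <= d a x) ->
  exists N (c : nat -> nat -> X), forall i, (i < n)%N ->
    [/\ forall t, K (c i t), forall t, d (c i t) (c i t.+1) < delta,
        forall t, 2 * i%:R * h - delta < d a (c i t) < (2 * i%:R + 1) * h + delta,
        d a (c i 0%N) <= 2 * i%:R * h & (2 * i%:R + 1) * h <= d a (c i N)].
Proof.
move=> H0 delta0 Ka [x ax Hx].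
have [c [M [c0 cM cK cd]]] := chain_reach_seq delta0 Ka ax.
pose f t := d a (c t).
have fS t : f t.+1 < f t + delta /\ f t < f t.+1 + delta.
  have := cd t; have := d_tri a (c t) (c t.+1); have := d_tri a (c t.+1) (c t).
  rewrite /f (d_sym (c t.+1)); lra.
have h_gt0 i : (i < n)%N -> 0 < h.
  by move=> ik; rewrite /h divr_gt0// mulr_gt0// ltr0n; lia.
have seg i : exists se : nat * nat, (i < n)%N -> [/\ (se.1 < se.2)%N, 
   f se.1 <= 2 * i%:R * h, (2 * i%:R + 1) * h <= f se.2 &
    forall t, (se.1 < t < se.2)%N -> 2 * i%:R * h < f t < (2 * i%:R + 1) * h].
  have [ik|nik] := ltnP i n; last by exists (0, 0)%N.
  have h0 := h_gt0 i ik.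
  have [||| s [e se]] := @crossing f (2 * i%:R * h) ((2 * i%:R + 1) * h) M.
  - by rewrite /f c0 d_refl !mulr_ge0 // ltW.
  - lra.
  - rewrite /f cM; apply: le_trans Hx.
    have -> : H = 2 * n%:R * h.
      by rewrite /h mulrC divfK// mulf_neq0// pnatr_eq0; lia.
    rewrite ler_pM2r//.
    have : i.+1%:R <= n%:R :> R by rewrite ler_nat.
    rewrite -natr1; lra.
  by exists (s, e).
move: seg => /choice[se seP].
(* Each piece starts at its [s] and is frozen at its [e], so that one length [N] suits all bands. *)
exists (\max_(i < n) (se i).2)%N, (fun i t => c (minn ((se i).1 + t) (se i).2)).
move=> i ik; have [] := seP i ik; case seE: (se i) => [s e] /= lt_se fs fe ft.
have h0 := h_gt0 i ik.
have fs' : 2 * i%:R * h - delta < f s.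
  have := fS s; have [->|ne] := eqVneq s.+1 e; first by lra.
  by have /ft : (s < s.+1 < e)%N; [lia|lra].
have fe' : f e < (2 * i%:R + 1) * h + delta.
  have [e1 eE] : exists e1, e = e1.+1 by exists e.-1; lia.
  have := fS e1; rewrite -eE; have [se1|ne] := eqVneq s e1; first by rewrite -se1; lra.
  by have /ft : (s < e1 < e)%N; [lia|lra].
split.
- by [].
- move=> t; have [te|te] := leqP e (s + t).
    by rewrite (minn_idPr _) ?d_refl //; lia.
  by rewrite addnS (minn_idPl te).
- move=> t; have [te|te] := leqP e (s + t).
    by rewrite -/(f e); lra.
  rewrite -/(f _).
  have [->|t0] := eqVneq t 0%N; first by rewrite addn0; lra.
  by have /ft : (s < s + t < e)%N; [lia|lra].
- by rewrite addn0 (minn_idPl (ltnW lt_se)).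
rewrite (minn_idPr _) //; apply: leq_trans (leq_addl _ _).
by have := @leq_bigmax 'I_n (fun j => (se j).2) (Ordinal ik); rewrite /= seE.
Qed.
End CompactMetric.

(** * Open sets of diagrams *)
Section Wasserstein.
Variables (R : realType) (X : Type) (d : X -> X -> R) (A : set X) (p : \bar R).
Hypothesis p_ge1 : (1%:E <= p)%E.
Hypothesis d_ge0 : forall x y, 0 <= d x y.
Hypothesis d_sym : forall x y, d x y = d y x.
Hypothesis d_refl : forall x, d x x = 0.
Implicit Types alpha beta : pd_diagram A.

Definition supp alpha : set X := [set x | (0 < pd_dmult alpha x)%N].

Lemma represents_supp alpha m (x : 'I_m -> X) y :
  pd_represents alpha x -> supp alpha y <-> exists i, x i = y.
Proof.
move=> [_ mE]; rewrite /supp /= mE /pd_mult lt0n sum_nat_eq0.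
split=> [/forallPn[i]|[i xi]].
  by case: asboolP => // <- _; exists i.
by apply/forallPn; exists i; rewrite asboolT.
Qed.

Lemma lp_norm_ge m k (a : 'I_m -> R) (P : pred 'I_k) (b : 'I_k -> R) :
  (forall i, 0 <= a i) -> (forall j, 0 <= b j) ->
  (forall i, ((a i)%:E <= pd_lp_norm p a P b)%E) /\
  (forall j, P j -> ((b j)%:E <= pd_lp_norm p a P b)%E).
Proof.
move=> a0 b0; case: p p_ge1 => [r||] //=; rewrite ?lee_fin => r1.
  have r0 : 0 < r by apply: lt_le_trans r1.
  have root c s : 0 <= c -> powR c r <= s -> c <= powR s r^-1.
    move=> c0 cs; rewrite -[leLHS](powRr1 c0) -(mulfV (lt0r_neq0 r0)) powRrM.
    apply: ge0_ler_powR; rewrite ?nnegrE ?powR_ge0 ?invr_ge0 ?(ltW r0) //.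
    exact: le_trans (powR_ge0 _ _) cs.
  have sa : 0 <= \sum_(i < m) powR (a i) r by apply: sumr_ge0 => i _; exact: powR_ge0.
  have sb : 0 <= \sum_(j < k | P j) powR (b j) r by apply: sumr_ge0 => i _; exact: powR_ge0.
  split=> [i|j Pj]; rewrite lee_fin; apply: root => //.
    rewrite (bigD1 i) //= -addrA lerDl addr_ge0 // sumr_ge0 // => j _; exact: powR_ge0.
  rewrite [in leRHS](bigD1 j) //= addrCA lerDl addr_ge0 // sumr_ge0 // => ? _; exact: powR_ge0.
split=> [i|j Pj]; rewrite lee_fin le_max; apply/orP.
  by left; apply: le_bigmax.
by right; apply: le_bigmax_cond.
Qed.

(** The [p]-cost dominates every single distance, so a cheap matching moves each point by less than
    [r], into the other diagram or into [A]. *)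
Lemma Wp_lt_supp alpha beta r : (pd_Wp d A p alpha beta < r%:E)%E ->
  (forall x, supp alpha x ->
     (exists2 y, supp beta y & d x y < r) \/ (exists2 z, A z & d x z < r)) /\
  (forall y, supp beta y ->
     (exists2 x, supp alpha x & d x y < r) \/ (exists2 z, A z & d y z < r)).
Proof.
move=> /ereal_inf_lt[_ [m [x [k [y [phi [z [w [xr yr [phi_inj zA wA] ->]]]]]]]] cost].
have [] := @lp_norm_ge m k
  (fun i => match phi i with Some j => d (x i) (y j) | None => d (x i) (z i) end)
  (fun j => ~~ `[< exists i, phi i = Some j >]) (fun j => d (w j) (y j)).
- by move=> i; case: (phi i).
- by [].
move=> costx costy; split=> [x' /(represents_supp _ xr)[i <-]|y' /(represents_supp _ yr)[j <-]].
  have := le_lt_trans (costx i) cost; rewrite lte_fin; case phiE: (phi i) => [j|] dr.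
    by left; exists (y j) => //; apply/(represents_supp _ yr); exists j.
  by right; exists (z i) => //; exact: zA.
have [[i phiE]|nphi] := pselect (exists i, phi i = Some j).
  left; exists (x i); first by apply/(represents_supp _ xr); exists i.
  by have := le_lt_trans (costx i) cost; rewrite lte_fin phiE.
right; exists (w j); first by apply: wA => i phiE; apply: nphi; exists i.
rewrite d_sym -lte_fin; apply: le_lt_trans cost; apply: costy.
by apply/negP => /asboolP.
Qed.

(** For [n >= 1] the identity matching costs at most [n^(1/p) r], hence at most [n r]; the empty
    diagram is treated apart. *)
Lemma Wp_le alpha beta n (x y : 'I_n -> X) r : 0 <= r ->
  pd_represents alpha x -> pd_represents beta y -> (forall i, d (x i) (y i) <= r) ->
  (pd_Wp d A p alpha beta <= (n%:R * r)%:E)%E.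
Proof.
move=> r0 xr yr xy.
apply: (@le_trans _ _ (pd_matching_cost d p x y Some x y)).
  apply: ereal_inf_lbound; exists n, x, n, y, Some, x, y; split=> //.
  by split=> [i i' j [->] [->]|//|j /(_ j)].
rewrite /pd_matching_cost.
have P0 : (fun j : 'I_n => ~~ `[< exists i, Some i = Some j >]) =1 pred0.
  by move=> j; apply/negbTE; rewrite negbK; apply/asboolP; exists j.
case: n x y xr yr xy P0 => [|n] x y xr yr xy P0.
  case: p p_ge1 => [q||] //=; rewrite ?lee_fin => q1.
    by rewrite !big_ord0 addr0 powR0 ?mul0r// invr_neq0// gt_eqF//; apply: lt_le_trans q1.
  by rewrite !big_ord0 mul0r maxxx.
have rnr : r <= n.+1%:R * r by rewrite -[leLHS]mul1r ler_wpM2r// ler1n.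
case: p p_ge1 => [q||] //=; rewrite ?lee_fin => q1; rewrite (eq_bigl _ _ P0) big_pred0_eq.
  rewrite addr0; have q0 : 0 < q by apply: lt_le_trans q1.
  apply: (@le_trans _ _ (powR (n.+1%:R * powR r q) q^-1)).
    apply: ge0_ler_powR; rewrite ?nnegrE ?invr_ge0 ?(ltW q0) ?mulr_ge0 ?powR_ge0//.
      by apply: sumr_ge0 => i _; exact: powR_ge0.
    rewrite -[n.+1 in leRHS]card_ord mulr_natl -sumr_const.
    by apply: ler_sum => i _; apply: ge0_ler_powR; rewrite ?nnegrE ?(ltW q0).
  rewrite powRM ?powR_ge0// -powRrM mulfV ?lt0r_neq0// powRr1//.
  rewrite ler_wpM2r// -[leRHS]powRr1//; apply: ler_powR; first by rewrite ler1n.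
  by rewrite invf_le1.
rewrite ge_max; apply/andP; split; last exact: le_trans rnr.
by apply/bigmax_leP; split=> [|i _]; apply: le_trans rnr.
Qed.

Section Thresholds.
Variables (g : X -> R) (c : R).
Hypothesis g_lip : forall x y, g x <= g y + d x y.
Hypothesis gA : forall z, A z -> g z <= 0.
Hypothesis c_gt0 : 0 < c.

(** With G the maximum of [g] over the points of the diagram (0 if there are none), these are the
    sets G > c and G < c. *)
Definition some_gt : set (pd_diagram A) := [set alpha | exists2 x, supp alpha x & c < g x].
Definition all_lt : set (pd_diagram A) := [set alpha | forall x, supp alpha x -> g x < c].

Lemma some_gt_open : pd_mopen (pd_Wp d A p) some_gt.
Proof.
move=> alpha [x sx cx]; exists (g x - c); first by rewrite subr_gt0.
move=> beta /Wp_lt_supp[/(_ x sx)[[y sy xy]|[z Az xz]] _].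
  by exists y => //; have := g_lip x y; clear sx sy; lra.
by exfalso; have := g_lip x z; have := gA Az; clear sx; have := c_gt0; lra.
Qed.

Lemma all_lt_open : pd_mopen (pd_Wp d A p) all_lt.
Proof.
move=> alpha alt; have [m [x xr]] := pd_dmult_finsum alpha.
have [||r r0 xP] := @finite_uniform_gt0 R 'I_m setT (fun i r => g (x i) + r <= c).
- exact: finite_finset.
- move=> i _; exists (c - g (x i)); last by rewrite addrC subrK.
  by rewrite subr_gt0; apply: alt; apply/(represents_supp _ xr); exists i.
(* [r] controls the points matched into [alpha], and [c] those matched into [A]. *)
exists (Num.min r c) => [|beta /Wp_lt_supp[_ bP] y /bP].
  by rewrite lt_min r0.
move=> [[_ /(represents_supp _ xr)[i <-] xy]|[z Az yz]].
  have [r' rr' xr'] := xP i I; have := g_lip y (x i); rewrite d_sym.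
  by move: xy; rewrite lt_min => /andP[? _]; lra.
by have := g_lip y z; have := gA Az; move: yz; rewrite lt_min => /andP[_]; lra.
Qed.
End Thresholds.
End Wasserstein.

Lemma mopen_forall (R : realType) (T : Type) (e : T -> T -> \bar R) (n : nat)
  (P : 'I_n -> set T) : (forall i, pd_mopen e (P i)) ->
  pd_mopen e [set t | forall i, P i t].
Proof.
move=> Popen t Pt.
have [||r r0 rP] := @finite_uniform_gt0 R 'I_n setT
    (fun i r => forall t', (e t t' < r%:E)%E -> P i t').
- exact: finite_finset.
- by move=> i _; have [r r0 rP] := Popen i t (Pt i); exists r.
exists r => // t' tt' i; have [r' rr' r'P] := rP i I.
by apply: r'P; apply: lt_le_trans tt' _; rewrite lee_fin.
Qed.

(** The Kuhn label of a vertex whose large coordinates are those in [T]; [find] returns [n] when [T]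
    is full. *)
Definition first_missing (n : nat) (T : {set 'I_n}) : nat :=
  find (fun i => i \notin T) (enum 'I_n).

Lemma first_missing_le n (T : {set 'I_n}) : (first_missing T <= n)%N.
Proof. by rewrite -[leqRHS](size_enum_ord n) find_size. Qed.

Lemma first_missing_le_notin n (T : {set 'I_n}) (i : 'I_n) :
  i \notin T -> (first_missing T <= i)%N.
Proof.
move=> iT; rewrite leqNgt; apply/negP => /(before_find i).
by rewrite nth_ord_enum iT.
Qed.

Lemma first_missing_neq_in n (T : {set 'I_n}) (i : 'I_n) :
  i \in T -> first_missing T <> i.
Proof.
move=> iT fi; have : has (fun i => i \notin T) (enum 'I_n).
  by rewrite has_find -/(first_missing T) fi size_enum_ord.
by move=> /(nth_find i); rewrite -/(first_missing T) fi nth_ord_enum iT.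
Qed.

(** * Tent functions of the distance to [a] *)

Section Tents.
Variables (R : realType) (X : Type) (d : X -> X -> R).
Hypothesis d_sym : forall x y, d x y = d y x.
Hypothesis d_tri : forall x y z, d x z <= d x y + d y z.
Variables (a : X) (h : R).

(** Left negative outside the interval from [2ih] to [(2i+2)h]: it is only compared with positive
    thresholds. *)
Definition tent (i : nat) (x : X) : R := h - `|d a x - (2 * i%:R + 1) * h|.

Lemma tent_lip i x y : tent i x <= tent i y + d x y.
Proof.
rewrite /tent; have := d_tri a x y; have := d_tri a y x; rewrite (d_sym y x).
set u := (2 * i%:R + 1) * h; case: (ger0P (d a x - u)); case: (ger0P (d a y - u)); lra.
Qed.

Lemma tent_le0 i x : d a x <= 2 * i%:R * h \/ (2 * i%:R + 2) * h <= d a x -> tent i x <= 0.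
Proof.
rewrite /tent => H; case: (ger0P (d a x - (2 * i%:R + 1) * h)) => ?; case: H => ?; nra.
Qed.

(** Later bands start where the tent has come down to 0, and earlier ones end a gap [h] before it
    rises, so an overshoot [delta] lifts it to at most [h / 3]. *)
Lemma tent_other_band i j delta x : i != j -> 0 < h -> delta <= h / 3 ->
  2 * j%:R * h - delta < d a x < (2 * j%:R + 1) * h + delta -> tent i x <= h / 3.
Proof.
move=> ij h0 dh /andP[xl xu]; rewrite /tent; move: ij; rewrite neq_ltn => /orP[ij|ji].
  have : i.+1%:R <= j%:R :> R by rewrite ler_nat.
  rewrite -natr1 -subr_ge0 => /(mulr_ge0 (ltW h0)) ?.
  by case: (ger0P (d a x - (2 * i%:R + 1) * h)) => ?; nra.
have : j.+1%:R <= i%:R :> R by rewrite ler_nat.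
rewrite -natr1 -subr_ge0 => /(mulr_ge0 (ltW h0)) ?.
by case: (ger0P (d a x - (2 * i%:R + 1) * h)) => ?; nra.
Qed.

Lemma tent_top i delta x : delta <= h / 3 ->
  (2 * i%:R + 1) * h <= d a x -> d a x < (2 * i%:R + 1) * h + delta ->
  2 * h / 3 <= tent i x.
Proof. by rewrite /tent => ? ? ?; rewrite ger0_norm; lra. Qed.
End Tents.

(** * Dimension of spaces of diagrams *)

Section DiagramDimension.
Variables (R : realType) (X : Type) (d : X -> X -> R) (A : set X) (p : \bar R).
Hypothesis p_ge1 : (1%:E <= p)%E.
Hypothesis d_ge0 : forall x y, 0 <= d x y.
Hypothesis d_refl : forall x, d x x = 0.
Hypothesis d_sym : forall x y, d x y = d y x.
Hypothesis d_tri : forall x y z, d x z <= d x y + d y z.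
Variables (K : set X) (a : X) (H : R).
Hypothesis K_compact : pd_mcompact (pd_edist d) K.
Hypothesis KA : forall x, K x -> ~ A x.
Hypothesis Ka : K a.
Hypothesis H_gt0 : 0 < H.
Hypothesis chains : forall delta, 0 < delta -> exists2 x, chain_reach d K delta a x & H <= d a x.
Hypothesis far : forall z, A z -> H <= d a z.

Lemma diagram_of (n : nat) (x : nat -> X) : (forall i, (i < n)%N -> K (x i)) ->
  exists alpha : pd_diagram A, pd_represents alpha (fun i : 'I_n => x i).
Proof.
move=> Kx; have xA (i : 'I_n) : ~ A (x i) by apply/KA/Kx.
by exists (pd_Diagram (ex_intro _ n (ex_intro _ (fun i : 'I_n => x i) (conj xA erefl)))).
Qed.

(** A Lebesgue number for the cover [V] along [K^n], each tuple being read as a diagram. *)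
Lemma refinement_radius (n : nat) (S : set (pd_diagram A)) (V : set (set (pd_diagram A))) :
  (0 < n)%N -> pd_Dn A n `<=` S ->
  (forall v, V v -> pd_relopen (pd_mopen (pd_Wp d A p)) S v) -> S `<=` \bigcup_(v in V) v ->
  exists2 r, 0 < r & forall x, (forall i, (i < n)%N -> K (x i)) ->
    exists2 v, V v & forall x', (forall i, (i < n)%N -> K (x' i)) ->
      (forall i, (i < n)%N -> d (x i) (x' i) < r) ->
      forall alpha, pd_represents alpha (fun i : 'I_n => x' i) -> v alpha.
Proof.
move=> n0 DnS Vopen SV.
have inS x alpha : pd_represents alpha (fun i : 'I_n => x i) -> S alpha.
  by move=> xr; apply: DnS; exists n, (fun i : 'I_n => x i).
have nR0 : (0 : R) < n%:R by rewrite ltr0n.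
apply: (compact_power_uniform d_refl d_tri K_compact _ _ Ka).
- move=> x r r' rr' [v Vv vP]; exists v => // x' Kx' xx'; apply: vP => // i ik.
  exact: lt_le_trans (xx' i ik) rr'.
move=> x Kx; have [alpha xr] := diagram_of Kx.
have [v Vv valpha] := SV _ (inS _ _ xr).
have [w [wopen vE]] := Vopen v Vv.
have [s s0 sw] : exists2 s : R, 0 < s & forall beta, (pd_Wp d A p alpha beta < s%:E)%E -> w beta.
  by apply: wopen; move: valpha; rewrite vE => -[].
(* Two successive moves by [r] cost at most [n (r + r) = s / 2]. *)
pose r := s / (4 * n%:R).
have r0 : 0 < r by rewrite divr_gt0// mulr_gt0.
exists r => // x' Kx' xx'; exists v => // x'' Kx'' x'x'' beta x''r.
rewrite vE; split; last exact: inS x''r.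
apply: sw; apply: le_lt_trans (Wp_le p_ge1 d_ge0 (r := r + r) _ xr x''r _) _.
- by rewrite addr_ge0// ltW.
- move=> i; have := d_tri (x i) (x' i) (x'' i).
  by have := xx' i (ltn_ord i); have := x'x'' i (ltn_ord i); lra.
rewrite lte_fin (_ : n%:R * (r + r) = s / 2); first by lra.
by rewrite /r; field; rewrite gt_eqF.
Qed.

(** A general [S] containing D^n serves both D^n itself and the space of all diagrams. *)
Lemma diagrams_not_covdim_le (n m : nat) (S : set (pd_diagram A)) :
  (m < n)%N -> pd_Dn A n `<=` S -> ~ pd_covdim_le (pd_mopen (pd_Wp d A p)) S m.
Proof.
move=> mn DnS dimS.
have n0 : (0 < n)%N by apply: leq_trans mn.
have nR0 : (0 : R) < n%:R by rewrite ltr0n.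
pose h := H / (2 * n%:R).
have h0 : 0 < h by rewrite divr_gt0// mulr_gt0.
have HE : H = 2 * n%:R * h by rewrite /h; field; rewrite gt_eqF.
pose g := tent d a h.
have g_lip i x y : g i x <= g i y + d x y by exact: tent_lip.
have gA (i : 'I_n) z : A z -> g i z <= 0.
  move=> /far Hz; apply: tent_le0 => //; right; apply: le_trans Hz; rewrite HE ler_pM2r//.
  have : i.+1%:R <= n%:R :> R by rewrite ler_nat.
  rewrite -natr1; lra.
(* G_i, the maximum of [g i], is above [h / 3] for [i] in [T] and below [2h / 3] otherwise. The two
   ranges overlap, so the open sets [W T] cover everything. *)
pose P (T : {set 'I_n}) (i : 'I_n) : set (pd_diagram A) :=
  if i \in T then some_gt (A := A) (g i) (h / 3) else all_lt (A := A) (g i) (2 * h / 3).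
pose W T := [set alpha | forall i, P T i alpha].
have Wopen T : pd_mopen (pd_Wp d A p) (W T).
  apply: mopen_forall => i; rewrite /P; case: ifP => _.
    by apply: some_gt_open => //; [exact: gA|lra].
  by apply: all_lt_open => //; [exact: gA|lra].
have [||V [Vopen SV VW Vorder]] := dimS [set u | exists T, u = W T `&` S].
- by move=> _ [T ->]; exists (W T).
- move=> alpha Salpha.
  pose T := [set i : 'I_n | `[< some_gt (A := A) (g i) (h / 3) alpha >]]%SET.
  exists (W T `&` S); first by exists T.
  split=> // i; rewrite /P inE; case: asboolP => // nsome x sx.
  rewrite ltNge; apply/negP => gx; apply: nsome; exists x => //.
  by apply: lt_le_trans gx; clear sx; lra.
have [r r0 Vr] := refinement_radius n0 DnS Vopen SV.
have /choice[TT TTP] : forall v, exists T, V v -> v `<=` W T.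
  move=> v.
  have [Vv|nVv] := pselect (V v); last by exists finset.set0.
  by have [_ [T ->] vW] := VW v Vv; exists T => _ alpha /vW[].
(* [delta <= r] puts adjacent grid vertices in a common member of [V]; [delta <= h / 3] keeps the
   other bands from making G_i large. *)
pose delta := Num.min r (h / 3).
have delta0 : 0 < delta by rewrite lt_min r0 divr_gt0.
have delta_r : delta <= r by rewrite ge_min lexx.
have delta_h : delta <= h / 3 by rewrite ge_min lexx orbT.
have [N [c cP]] := chain_bands d_refl d_sym d_tri n H_gt0 delta0 Ka (chains delta0).
pose pt (u : nat -> nat) i := c i (u i).
have Kpt u i : (i < n)%N -> K (pt u i) by move=> /cP[cK _ _ _ _]; exact: cK.
(* [vv u] is a member of [V] around the vertex [u], containing every diagram whose points are
   [r]-close to those of [u]; it determines the label of [u]. *)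
have /choice[vv vvP] : forall u, exists v, V v /\ forall x', (forall i, (i < n)%N -> K (x' i)) ->
      (forall i, (i < n)%N -> d (pt u i) (x' i) < r) ->
      forall alpha, pd_represents alpha (fun i : 'I_n => x' i) -> v alpha.
  by move=> u; have [v Vv vP] := Vr _ (Kpt u); exists v.
have Wvv u i : exists2 alpha, pd_represents alpha (fun i : 'I_n => pt u i) &
    P (TT (vv u)) i alpha.
  have [alpha ptr] := diagram_of (Kpt u); exists alpha => //.
  have [Vv vP] := vvP u; apply: TTP (Vv) _ _ i; apply: vP ptr; first exact: Kpt.
  by move=> j jn; rewrite d_refl.
have band u (i : 'I_n) : 2 * i%:R * h - delta < d a (pt u i) < (2 * i%:R + 1) * h + delta.
  by have [_ _ + _ _] := cP i (ltn_ord i); exact.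
have [|||vs [b vsb] vs_label] := @kuhn N n (fun u => first_missing (TT (vv u))).
- by move=> u _; exact: first_missing_le.
(* At [u i = 0] the point in band [i] has tent at most 0 and the others at most [h / 3], so [i] is
   not in [T]. *)
- move=> u i _ ik ui0; apply: (first_missing_le_notin (i := Ordinal ik)).
  apply/negP => iT; have [alpha ptr] := Wvv u (Ordinal ik); rewrite /P iT.
  move=> [_ /(represents_supp _ ptr)[j <-]]; apply/negP; rewrite -leNgt.
  have [->|ij] := eqVneq j (Ordinal ik).
    apply: (@le_trans _ _ 0); last by lra.
    apply: tent_le0 => //; left; rewrite /pt /= ui0.
    by have [_ _ _ + _] := cP i ik.
  by apply: tent_other_band delta_h (band u j) => //; rewrite eq_sym.
(* At [u i = N] the point in band [i] has tent at least [2h / 3], so [i] is in [T]. *)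
- move=> u i _ ik uiN; apply: (first_missing_neq_in (i := Ordinal ik)).
  apply: contrapT => /negP/negbTE iT; have [alpha ptr] := Wvv u (Ordinal ik); rewrite /P iT.
  move=> /(_ (pt u i)) Pu.
  have {Pu} : g i (pt u i) < 2 * h / 3.
    by apply: Pu; apply/(represents_supp _ ptr); exists (Ordinal ik).
  apply/negP; rewrite -leNgt; have /andP[_ ub] := band u (Ordinal ik).
  apply: tent_top delta_h _ ub; rewrite /pt uiN.
  by have [_ _ _ _] := cP i ik.
have label_ex l : (l <= n)%N -> exists2 u, u \in vs & first_missing (TT (vv u)) = l.
  move=> ln; have /mapP[u uvs ->] : l \in map (fun u => first_missing (TT (vv u))) vs.
    by rewrite (perm_mem vs_label) mem_iota.
  by exists u.
have /choice[f fP] (i : 'I_m.+2) : exists u, u \in vs /\ first_missing (TT (vv u)) = i.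
  have [|u ? ?] := label_ex i; last by exists u.
  by have := ltn_ord i; lia.
have [u0 u0vs _] := label_ex 0%N isT.
have [alpha ptr] := diagram_of (Kpt u0).
(* Distinct labels make these [m + 2] members of [V] distinct, yet all contain the diagram of [u0]:
   inside a cell each coordinate changes by at most one chain step. *)
apply: (Vorder (vv \o f) _ _ alpha) => [i j /= fij|i|i].
- by apply: ord_inj; have [_ <-] := fP i; have [_ <-] := fP j; rewrite fij.
- by have [] := vvP (f i).
have [_ vP] := vvP (f i); apply: vP ptr; first exact: Kpt.
move=> j jn; apply: lt_le_trans delta_r; rewrite /pt.
have := vsb _ u0vs j; have [fvs _] := fP i; have := vsb _ fvs j; rewrite jn => -[l1 u1 _] [l2 u2 _].
have [_ cd _ _ _] := cP j jn.
have [->|ne] := eqVneq (f i j) (u0 j); first by rewrite d_refl.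
have [[-> ->]|[-> ->]] : (f i j = b j /\ u0 j = (b j).+1) \/ (f i j = (b j).+1 /\ u0 j = b j) by lia.
  exact: cd.
by rewrite d_sym; exact: cd.
Qed.
End DiagramDimension.

Theorem theorem8p9 (R : realType) (X : Type) (d : X -> X -> R) (A : set X)
  (p : \bar R) (hp : (1%:E <= p)%E)
  (d_ge0 : forall x y, 0 <= d x y)
  (d_refl : forall x, d x x = 0)
  (d_sym : forall x y, d x y = d y x)
  (d_tri : forall x y z, d x z <= d x y + d y z)
  (d_sep : forall x y, d x y = 0 -> x = y)
  (A_closed : pd_mclosed (pd_edist d) A)
  (x0 : X) (eps : R) (eps_gt0 : 0 < eps)
  (ball_compact : pd_mcompact (pd_edist d) (pd_cball d x0 eps))
  (ball_dim : pd_covdim_ge (pd_mopen (pd_edist d)) (pd_cball d x0 eps) 2)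
  (ball_far : pd_cball d x0 eps `&` pd_thick d A (3 * eps) = set0) :
  (forall n : nat, pd_covdim_ge (pd_mopen (pd_Wp d A p)) (pd_Dn A n) n) /\
  pd_covdim_infinite (pd_mopen (pd_Wp d A p)) [set: pd_diagram A].
Proof.
set K := pd_cball d x0 eps in ball_compact ball_dim ball_far *.
have K_far y z : K y -> A z -> 3 * eps <= d y z.
  move=> Ky Az; rewrite leNgt; apply/negP => yz.
  have : (K `&` pd_thick d A (3 * eps)) y.
    split=> //; apply: (@le_lt_trans _ _ (d y z)%:E); last by rewrite lte_fin.
    by apply: ereal_inf_lbound; exists z.
  by rewrite ball_far.
have KA x : K x -> ~ A x.
  by move=> Kx /(K_far _ _ Kx); rewrite d_refl; lra.
have [a [H [Ka H_gt0 chains]]] :=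
  chains_of_covdim_gt0 d_refl d_sym d_tri ball_compact (ball_dim 0%N isT).
(* Two points of the ball are at most [2 * eps] apart, so [H <= 2 * eps], while
   [3 * eps <= d a z]. *)
have far z : A z -> H <= d a z.
  move=> /(K_far _ _ Ka) az; have [x ax Hx] := chains 1 ltr01.
  have Kx : K x by exact: chain_reach_mem ax.
  have := d_tri a x0 x; move: (Ka) Kx; rewrite /K /pd_cball /= (d_sym x0 a); lra.
have dimS n m S := @diagrams_not_covdim_le R X d A p hp d_ge0 d_refl d_sym d_tri
  K a H ball_compact KA Ka H_gt0 chains far n m S.
(* The space of all diagrams contains D^n for every [n]; [n = m + 1] excludes dimension at most
   [m]. *)
by split=> [n m mn|m]; [exact: dimS mn _|exact: dimS (ltnSn m) _].
Qed.
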